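(* Let $\mathcal{H}$ be a complex Hilbert space and let $T\in\mathcal{B}(\mathcal{H})$. Then for every $\alpha\in[0,1]$, $$\|T\|_{\alpha}^2\leq\frac{\alpha}{4}w^2(|T|+i|T^*|)+\frac{\alpha}{4}w(|T||T^*|)+\left\|\left(1-\frac{7\alpha}{8}\right)|T|^2+\frac{\alpha}{8}|T^*|^2\right\|.$$
   Context: $\mathcal{B}(\mathcal{H})$ denotes the $C^*$-algebra of all bounded linear operators on the complex Hilbert space $\mathcal{H}$, and $\|\cdot\|$ is the operator norm. For $T\in\mathcal{B}(\mathcal{H})$, $|T|=(T^*T)^{1/2}$ and $|T^*|=(TT^* )^{1/2}$. The numerical radius is $w(T)=\sup\{|\langle Tx,x\rangle|: x\in\mathcal{H},\ \|x\|=1\}$, and $w^2(\cdot)=(w(\cdot))^2$. For $0\leq\alpha\leq1$ the $\alpha$-norm of $T$ is $$\|T\|_{\alpha}=\sup\left\{\sqrt{\alpha|\langle Tx,x\rangle|^2+(1-\alpha)\|Tx\|^2}: x\in\mathcal{H},\ \|x\|=1\right\}.$$ *)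

(* Defs.v *)
From HB Require Import structures.
From mathcomp Require Import all_boot all_order all_algebra.
From mathcomp Require Import sesquilinear complex.
From mathcomp Require Import all_classical all_reals all_analysis.

Set Implicit Arguments.
Unset Strict Implicit.
Unset Printing Implicit Defensive.
Import Order.TTheory GRing.Theory Num.Theory.
Import numFieldNormedType.Exports.

Local Open Scope classical_set_scope.
Local Open Scope ring_scope.

(* {dot H for Num.conj} : linear in the first argument, conjugate-linear in
   the second, positive definite.  The dimension is arbitrary; H may be 0. *)
HB.mixin Record CompleteNormedModule_isHilbert (R : realType) (H : Type)
    of CompleteNormedModule R[i] H := {
  inner : {dot H for (@Num.conj R[i])} ;
  sqr_norm_inner : forall x : H, `|x| ^+ 2 = inner x x
}.

#[short(type="hilbertType")]
HB.structure Definition Hilbert (R : realType) :=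
  { H of CompleteNormedModule R[i] H & CompleteNormedModule_isHilbert R H }.

Notation "<[ x , y ]>" := (inner x y) : ring_scope.

(* On R[i] and on a normed space over it the library norm takes its values in
   R[i] (real and nonnegative); rnorm x is that value as an element of R. *)
Notation rnorm x := (complex.Re `|x|).

Section Operators.
Variables (R : realType) (H : hilbertType R).
Implicit Types A S T : H -> H.

Definition bounded_operator T : Prop :=
  linear T /\ exists M : R, forall x, rnorm (T x) <= M * rnorm x.

Definition is_adjoint T S : Prop :=
  bounded_operator S /\ forall x y, <[T x, y]> = <[x, S y]>.

(* The adjoint of a bounded operator exists and is unique (Riesz); the default
   0 is returned only when T has no adjoint. *)
Definition adjoint T : H -> H := xget 0 [set S | is_adjoint T S].

(* In R[i], 0 <= z means that z is real and nonnegative. *)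
Definition positive_operator A : Prop :=
  bounded_operator A /\ forall x, 0 <= <[A x, x]>.

(* Every positive operator has exactly one positive square root; the default 0
   is returned only when A has none. *)
Definition sqrt_operator A : H -> H :=
  xget 0 [set S | positive_operator S /\ S \o S = A].

Definition abs_operator T : H -> H := sqrt_operator (adjoint T \o T).

(* The suprema below are taken in R, where sup set0 = 0; this only matters for
   the unit sphere of the zero space. *)
Definition operator_norm T : R :=
  sup [set rnorm (T x) | x in [set x : H | rnorm x <= 1]].

Definition numerical_radius T : R :=
  sup [set rnorm <[T x, x]> | x in [set x : H | rnorm x = 1]].

Definition alpha_norm (alpha : R) T : R :=
  sup [set Num.sqrt (alpha * rnorm <[T x, x]> ^+ 2
                     + (1 - alpha) * rnorm (T x) ^+ 2)
      | x in [set x : H | rnorm x = 1]].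

End Operators.

(* Main.v *)
Require Import Defs.
From mathcomp Require Import all_boot all_order all_algebra.
From mathcomp Require Import sesquilinear complex.
From mathcomp Require Import all_classical all_reals all_analysis.
From mathcomp Require Import ring lra.
Import Order.TTheory GRing.Theory Num.Theory.
Import numFieldNormedType.Exports.
Local Open Scope ring_scope.

(* Write A = |T|, B = |T*|, and for a unit vector x let a = <Ax, x> and
   b = <Bx, x>.  The mixed Schwarz inequality gives |<Tx, x>|^2 <= a b, and
   a b <= (a^2 + b^2) / 4 + a b / 2, where a^2 + b^2 = |<(A + iB)x, x>|^2.
   Buzano's inequality bounds a b / 2 by
   |<ABx, x>| / 4 + |Ax| |Bx| / 4 <= |<ABx, x>| / 4 + (|Ax|^2 + |Bx|^2) / 8.
   The quadratic terms combine with (1 - alpha) |Tx|^2 = (1 - alpha) |Ax|^2.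

   Existence of adjoints is the Riesz theorem.  Square roots of T*T are limits
   of polynomials in T*T, hence inherit intertwining relations; with uniqueness
   of positive roots this gives T A = B T.  For x = Au, mixed Schwarz is then
   the Cauchy-Schwarz inequality of the form <B., .> applied to Tu and y; the
   general case follows as the range of A is dense modulo the kernel of A. *)

Set Implicit Arguments.
Unset Strict Implicit.
Unset Printing Implicit Defensive.

Notation rinner x y := (complex.Re <[x, y]>).

(** * Real part, imaginary part and modulus of complex scalars *)

Section ComplexParts.
Local Open Scope complex_scope.
Variable R : realType.
Implicit Types z w : R[i].

Lemma ReD z w : complex.Re (z + w) = complex.Re z + complex.Re w.
Proof. by case: z w => [? ?] [? ?]. Qed.

Lemma ImD z w : complex.Im (z + w) = complex.Im z + complex.Im w.
Proof. by case: z w => [? ?] [? ?]. Qed.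

Lemma ReN z : complex.Re (- z) = - complex.Re z.
Proof. by case: z. Qed.

Lemma ImN z : complex.Im (- z) = - complex.Im z.
Proof. by case: z. Qed.

Lemma ReM z w :
  complex.Re (z * w) = complex.Re z * complex.Re w - complex.Im z * complex.Im w.
Proof. by case: z w => [? ?] [? ?]. Qed.

Lemma ImM z w :
  complex.Im (z * w) = complex.Re z * complex.Im w + complex.Im z * complex.Re w.
Proof. by case: z w => [? ?] [? ?]. Qed.

Lemma rnorm_sqr z : rnorm z ^+ 2 = complex.Re z ^+ 2 + complex.Im z ^+ 2.
Proof. by rewrite normc_def /= sqr_sqrtr // addr_ge0 ?sqr_ge0. Qed.

Lemma rnormc_ge0 z : 0 <= rnorm z.
Proof. by rewrite normc_def sqrtr_ge0. Qed.

Lemma rnormcE z : `|z| = (rnorm z)%:C.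
Proof. by rewrite RRe_real. Qed.

Lemma rnormcD z w : rnorm (z + w) <= rnorm z + rnorm w.
Proof.
have := ler_normD z w.
by rewrite (rnormcE (z + w)) (rnormcE z) (rnormcE w) -rmorphD lecR.
Qed.

Lemma Re_le_rnorm z : complex.Re z <= rnorm z.
Proof.
rewrite -lecR -rnormcE; apply: le_trans (normc_ge_Re _).
by rewrite lecR ler_norm.
Qed.

Lemma rnormc_eq0 z : rnorm z = 0 -> z = 0.
Proof. by move=> h; apply: normr0_eq0; rewrite rnormcE h. Qed.

End ComplexParts.

(** * Inner product and norm, read in the reals *)

Section Basics.
Local Open Scope complex_scope.
Variables (R : realType) (H : hilbertType R).
Implicit Types (x y z : H) (c : R[i]) (t : R).

(** The library norm lives in [R[i]]; this equation carries its inequalities over to the order of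
    [R]. *)
Lemma rnormE x : `|x| = (rnorm x)%:C.
Proof. by rewrite RRe_real. Qed.

Lemma rnorm_ge0 x : 0 <= rnorm x.
Proof. by have := normr_ge0 x; rewrite [X in 0 <= X]rnormE ler0c. Qed.

Lemma inner_conj x y : <[x, y]> = (<[y, x]>)^*.
Proof. by rewrite hermC /= expr0 mul1r. Qed.

Lemma rinnerC x y : rinner x y = rinner y x.
Proof. by rewrite inner_conj; case: <[_, _]>. Qed.

Lemma iminnerC x y : complex.Im <[x, y]> = - complex.Im <[y, x]>.
Proof. by rewrite inner_conj; case: <[_, _]>. Qed.

Lemma innerDl x y z : <[x + y, z]> = <[x, z]> + <[y, z]>.
Proof. exact: linearDl. Qed.

Lemma innerDr x y z : <[z, x + y]> = <[z, x]> + <[z, y]>.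
Proof. exact: linearDr. Qed.

Lemma innerZl c x z : <[c *: x, z]> = c * <[x, z]>.
Proof. exact: linearZl_LR. Qed.

Lemma innerZr c x z : <[z, c *: x]> = c^* * <[z, x]>.
Proof. exact: linearZr_LR. Qed.

Lemma innerNl x z : <[- x, z]> = - <[x, z]>.
Proof. exact: linearNl. Qed.

Lemma innerNr x z : <[z, - x]> = - <[z, x]>.
Proof. exact: linearNr. Qed.

Lemma inner0l z : <[0, z]> = 0 :> R[i].
Proof. exact: linear0l. Qed.

Lemma inner0r z : <[z, 0]> = 0 :> R[i].
Proof. exact: linear0r. Qed.

Lemma rinnerDl x y z : rinner (x + y) z = rinner x z + rinner y z.
Proof. by rewrite innerDl ReD. Qed.

Lemma rinnerDr x y z : rinner z (x + y) = rinner z x + rinner z y.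
Proof. by rewrite innerDr ReD. Qed.

Lemma rinnerNl x z : rinner (- x) z = - rinner x z.
Proof. by rewrite innerNl ReN. Qed.

Lemma rinnerNr x z : rinner z (- x) = - rinner z x.
Proof. by rewrite innerNr ReN. Qed.

Lemma rinnerZl t x z : rinner (t%:C *: x) z = t * rinner x z.
Proof. by rewrite innerZl ReM /= mul0r subr0. Qed.

Lemma rinnerZr t x z : rinner z (t%:C *: x) = t * rinner z x.
Proof. by rewrite rinnerC rinnerZl rinnerC. Qed.

Lemma rinner0l z : rinner 0 z = 0 :> R.
Proof. by rewrite inner0l. Qed.

Lemma rinner0r z : rinner z 0 = 0 :> R.
Proof. by rewrite inner0r. Qed.

Definition rinnerE := (rinnerDl, rinnerDr, rinnerNl, rinnerNr, rinnerZl,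
  rinnerZr, rinner0l, rinner0r).

(** Rotation by i turns imaginary parts into real ones, so an identity of real parts that holds for
    all vectors yields the complex identity. *)
Lemma rinneriZ x y : rinner ('i *: x) y = - complex.Im <[x, y]>.
Proof. by rewrite innerZl -complexiE ReM /= mul0r sub0r mul1r. Qed.

Lemma inner_xx x : <[x, x]> = (rnorm x ^+ 2)%:C.
Proof. by rewrite -sqr_norm_inner rnormE -rmorphXn. Qed.

Lemma rnorm2 x : rnorm x ^+ 2 = rinner x x.
Proof. by rewrite inner_xx. Qed.

Lemma rnorm_eq0 x : rnorm x = 0 -> x = 0.
Proof. by move=> h; apply: normr0_eq0; rewrite rnormE h. Qed.

Lemma rnorm0 : rnorm (0 : H) = 0.
Proof. by rewrite normr0. Qed.

Lemma rnormD x y : rnorm (x + y) <= rnorm x + rnorm y.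
Proof. by rewrite -lecR rmorphD /= -!rnormE ler_normD. Qed.

Lemma rnormN x : rnorm (- x) = rnorm x.
Proof. by rewrite normrN. Qed.

Lemma rnormBC x y : rnorm (x - y) = rnorm (y - x).
Proof. by rewrite -opprB rnormN. Qed.

Lemma rnormB x y : rnorm (x - y) <= rnorm x + rnorm y.
Proof. by rewrite -(rnormN y) rnormD. Qed.

Lemma rnormZ c x : rnorm (c *: x) = rnorm c * rnorm x.
Proof. by rewrite normrZ (rnormE x) ReM /= mulr0 subr0. Qed.

Lemma rnormC t : 0 <= t -> rnorm (t%:C : R[i]) = t.
Proof. by move=> t0; rewrite ger0_norm // ler0c. Qed.

Lemma rnormZr t x : 0 <= t -> rnorm (t%:C *: x) = t * rnorm x.
Proof. by move=> t0; rewrite rnormZ rnormC. Qed.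

End Basics.

(** * Linear maps, positive forms and the Cauchy-Schwarz inequality *)

Section Forms.
Local Open Scope complex_scope.
Variables (R : realType) (H : hilbertType R).
Implicit Types (x y z : H) (S A : H -> H).

Lemma linD S x y : linear S -> S (x + y) = S x + S y.
Proof. by move=> l; rewrite -[x]scale1r l !scale1r. Qed.

Lemma lin0 S : linear S -> S 0 = 0.
Proof. by move=> l; apply: (addrI (S 0)); rewrite -linD // !addr0. Qed.

Lemma linZ S c x : linear S -> S (c *: x) = c *: S x.
Proof. by move=> l; rewrite -[c *: x]addr0 l lin0 // addr0. Qed.

Lemma linN S x : linear S -> S (- x) = - S x.
Proof. by move=> l; rewrite -scaleN1r linZ // scaleN1r. Qed.

Lemma linB S x y : linear S -> S (x - y) = S x - S y.
Proof. by move=> l; rewrite linD // linN. Qed.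

Lemma lin_comp S A : linear S -> linear A -> linear (S \o A).
Proof. by move=> hS hA c x y /=; rewrite hA hS. Qed.

(* Polarization: over the complex field, positivity forces symmetry. *)
Lemma positive_symmetric S : linear S -> (forall x, 0 <= <[S x, x]>) ->
  forall x y, <[S x, y]> = <[x, S y]>.
Proof.
move=> l p x y.
have e u : complex.Im <[S u, u]> = 0 by apply: ger0_Im.
(* The vectors x + y and x + iy give the imaginary and the real part of <Sx, y> = conj <Sy, x>. *)
have := e (x + y); have := e (x + 'i *: y).
rewrite !linD // linZ // !(innerDl, innerDr, innerZl, innerZr).
rewrite -complexiE !(ImD, ImM, ReM) /= !(ImM, ReM, e) /=.
rewrite [<[x, S y]>]inner_conj.
case: <[S x, y]> => a b; case: <[S y, x]> => c d /= h1 h2.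
by apply/eqP; rewrite eq_complex /=; apply/andP; split; apply/eqP; lra.
Qed.

(** Discriminant argument: the quadratic t -> <S(x + ty), x + ty> is nonnegative for all real t. *)
Lemma schwarz_form S x y : linear S -> (forall x, 0 <= <[S x, x]>) ->
  rinner (S x) y ^+ 2 <= rinner (S x) x * rinner (S y) y.
Proof.
move=> l p.
have q u : 0 <= rinner (S u) u by have := p u; rewrite lecE => /andP[].
have sym : rinner (S y) x = rinner (S x) y.
  by rewrite positive_symmetric // rinnerC.
have e t : 0 <= rinner (S x) x + t * rinner (S x) y *+ 2
    + t ^+ 2 * rinner (S y) y.
  have := q (x + t%:C *: y); rewrite linD // linZ // !rinnerE sym.
  by congr (_ <= _); ring.
move: e (q x) (q y).
set a := rinner (S x) x; set b := rinner (S x) y; set d := rinner (S y) y.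
move=> e a0 d0; have [d00|dn] := eqVneq d 0.
  rewrite d00 mulr0; have [->|bn] := eqVneq b 0; first by rewrite expr0n.
  (* For d = 0 the quadratic is affine in t, and at this t it takes the negative value -a - 2. *)
  have := e (- (a + 1) / b); rewrite d00 mulr0 addr0 mulfVK // mulr2n.
  by move=> ?; exfalso; lra.
have {d0}dp : 0 < d by rewrite lt_neqAle eq_sym dn.
(* The minimiser of the quadratic. *)
have := e (- b / d); rewrite -(ler_pM2r dp) mul0r.
suff -> : (a + - b / d * b *+ 2 + (- b / d) ^+ 2 * d) * d = a * d - b ^+ 2 by lra.
by field.
Qed.

(** Replacing y by wy with w = <Sx, y> makes the pairing equal to |w|^2, which is real; the real
    inequality then reads |w|^4 <= |w|^2 <Sx, x> <Sy, y>, and |w|^2 cancels. *)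
Lemma schwarz_form_norm S x y : linear S -> (forall x, 0 <= <[S x, x]>) ->
  rnorm <[S x, y]> ^+ 2 <= rinner (S x) x * rinner (S y) y.
Proof.
move=> l p; have [w0|wn] := eqVneq <[S x, y]> 0.
  rewrite w0 normr0 /= expr0n /= mulr_ge0 //.
    by have := p x; rewrite lecE => /andP[].
  by have := p y; rewrite lecE => /andP[].
set w := <[S x, y]> in wn *.
have := schwarz_form x (w *: y) l p.
rewrite linZ // !(innerZl, innerZr) -/w mulrCA mulrA.
have -> : w^* * w = (rnorm w ^+ 2)%:C.
  by rewrite mulrC -sqr_normc [RHS]rmorphXn; congr (_ ^+ _); rewrite RRe_real.
rewrite ReM /= mul0r subr0.
have wp : 0 < rnorm w ^+ 2.
  by rewrite exprn_gt0 // -ltcR RRe_real ?normr_gt0.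
by rewrite [_ ^+ 2 ^+ 2]expr2 [X in _ <= X]mulrCA ler_pM2l.
Qed.

End Forms.

(** * Limits expressed through errors K / (n + 1) *)

Section Rates.
Local Open Scope complex_scope.
Variable R : realType.
Implicit Types (a b K e : R) (n : nat).

Lemma rate_lt K e : 0 < e -> exists N, forall n, (N <= n)%N -> K / n.+1%:R < e.
Proof.
move=> e0; exists (Num.bound (K / e)) => n hn.
rewrite ltr_pdivrMr ?ltr0n // mulrC -ltr_pdivrMr //.
have [k0|k0] := leP 0 (K / e); last by rewrite (lt_le_trans k0).
apply: (lt_trans (archi_boundP k0)).
by rewrite ltr_nat ltnS.
Qed.

Lemma rate_le K a b : (forall n, a <= b + K / n.+1%:R) -> a <= b.
Proof.
move=> h; apply/ler_addgt0Pr => e e0.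
have [N hN] := @rate_lt K e e0.
by apply: (le_trans (h N)); rewrite lerD2l ltW // hN.
Qed.

Lemma rate_eq0 K a : (forall n, `|a| <= K / n.+1%:R) -> a = 0.
Proof.
move=> h; apply/eqP; rewrite -normr_le0; apply: (@rate_le K) => n.
by rewrite add0r.
Qed.

End Rates.

(** * Completeness with an explicit rate *)

Section Completeness.
Local Open Scope complex_scope.
Variables (R : realType) (H : hilbertType R).

(** The limit inherits the Cauchy rate: compare u n with a later term u m that is already within e
    of the limit. *)
Lemma rate_cvg (u : nat -> H) (K : R) :
  (forall n m, (n <= m)%N -> rnorm (u m - u n) <= K / n.+1%:R) ->
  exists l, forall n, rnorm (u n - l) <= K / n.+1%:R.
Proof.
move=> hu.
(* A positive element of [R[i]] is real, so each radius of the library topology comes from [R]. *)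
have real_eps (e : R[i]) : 0 < e -> e = (complex.Re e)%:C /\ 0 < complex.Re e.
  by rewrite ltcE /= => /andP[/eqP i0 ->]; split=> //; case: e i0 => ? ? /= ->.
have cu : cauchy (nbhs (u @ \oo)%classic).
  apply: cauchy_exP => e /real_eps[-> e0].
  have [N hN] := @rate_lt R K _ e0.
  exists (u N), N => // n /= Nn.
  rewrite -ball_normE /ball_ /= rnormE ltcR rnormBC.
  exact: le_lt_trans (hu _ _ Nn) (hN N (leqnn _)).
have /cvg_ex[l ul] : cvg (u @ \oo)%classic by exact: cauchy_cvg.
exists l => n; apply/ler_addgt0Pr => e e0.
have e0' : (0 : R[i]) < e%:C by rewrite ltcR.
have /cvgrPdist_lt /(_ _ e0')[N _ hN] := ul.
pose m := maxn N n.
have {hN} : `|l - u m| < e%:C by apply: hN; rewrite /= leq_maxl.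
rewrite rnormE ltcR rnormBC => h1.
rewrite -[u n](subrK (u m)) -addrA.
apply: (le_trans (rnormD _ _)); rewrite lerD ?(ltW h1) //.
by rewrite rnormBC hu // leq_maxr.
Qed.

End Completeness.

(** * Riesz representation and adjoints *)

Section Riesz.
Local Open Scope complex_scope.
Variables (R : realType) (H : hilbertType R).
Implicit Types (x y z : H) (S T : H -> H).

Lemma rinner_le x y : rinner x y <= rnorm x * rnorm y.
Proof.
have [//|h] := leP (rinner x y) 0.
  by move=> h; apply: (le_trans h); rewrite mulr_ge0 ?rnorm_ge0.
rewrite -ler_sqr ?nnegrE ?mulr_ge0 ?rnorm_ge0 ?(ltW h) // exprMn !rnorm2.
by apply: (@schwarz_form R H id x y) => // u; rewrite inner_xx ler0c sqr_ge0.
Qed.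

Lemma rnorm_inner_le x y : rnorm <[x, y]> <= rnorm x * rnorm y.
Proof.
rewrite -ler_sqr ?nnegrE ?rnormc_ge0 ?mulr_ge0 ?rnorm_ge0 // exprMn !rnorm2.
by apply: (@schwarz_form_norm R H id x y) => // u; rewrite inner_xx ler0c sqr_ge0.
Qed.

(* The representing vector minimises |x|^2 - 2 Re (f x); minimising sequences
   are Cauchy by the parallelogram law. *)
Lemma riesz (f : H -> R[i]) (M : R) : scalar f ->
  (forall x, rnorm (f x) <= M * rnorm x) -> exists z, forall x, f x = <[x, z]>.
Proof.
move=> lf bf; pose g x : R := complex.Re (f x).
have fD x y : f (x + y) = f x + f y by have := lf 1 x y; rewrite scale1r mul1r.
have f0 : f 0 = 0 by apply: (addrI (f 0)); rewrite -fD !addr0.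
have fZ c x : f (c *: x) = c * f x by have := lf c x 0; rewrite f0 !addr0.
have gD x y : g (x + y) = g x + g y by rewrite /g fD ReD.
have gZ (t : R) x : g (t%:C *: x) = t * g x.
  by rewrite /g fZ ReM /= mul0r subr0.
have gle x : g x <= M * rnorm x.
  by apply: le_trans (bf x); exact: Re_le_rnorm.
pose phi x : R := rinner x x - 2 * g x.
have phi_ge x : - M ^+ 2 <= phi x.
  rewrite /phi -rnorm2; have := gle x; have := sqr_ge0 (rnorm x - M).
  by nra.
pose A := [set phi x | x in [set: H]]%classic.
have hA : has_inf A.
  by split; [exists (phi 0), 0|exists (- M ^+ 2) => _ [x _ <-]].
have phi_inf x : inf A <= phi x by apply: ge_inf; [exact: hA.2|exists x].
(* The tolerance is a square because the distance estimate below takes a square root. *)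
have /choice[u hu] : forall n : nat, exists x, phi x < inf A + (n.+1%:R^-1) ^+ 2.
  move=> n; have e0 : (0 : R) < n.+1%:R^-1 ^+ 2.
    by rewrite exprn_gt0 // invr_gt0 ltr0n.
  by have [_ [x _ <-] h] := inf_adherent e0 hA; exists x.
have ninv_gt0 (n : nat) : 0 < n.+1%:R^-1 :> R by rewrite invr_gt0 ltr0n.
have cu n m : (n <= m)%N -> rnorm (u m - u n) <= 2 / n.+1%:R.
  move=> nm.
  have le_inv : m.+1%:R^-1 <= n.+1%:R^-1 :> R.
    by rewrite lef_pV2 ?posrE ?ltr0n // ler_nat ltnS.
  rewrite -ler_sqr ?nnegrE ?rnorm_ge0 ?mulr_ge0 ?(ltW (ninv_gt0 n)) // rnorm2.
  (* At the midpoint, phi is at least the infimum, while phi(u m) + phi(u n) - 2 phi(midpoint) = |u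
     m - u n|^2 / 2. *)
  have := phi_inf ((2^-1 : R)%:C *: (u m + u n)).
  have := hu n; have := hu m; rewrite /phi gZ gD !rinnerE.
  rewrite (rinnerC (u n) (u m)).
  have := ninv_gt0 m; have := ninv_gt0 n; move: le_inv.
  move: (n.+1%:R^-1) (m.+1%:R^-1) => a b ab a0 b0 h1 h2 h3.
  have : b ^+ 2 <= a ^+ 2 by rewrite ler_sqr ?nnegrE ?(ltW a0) ?(ltW b0).
  by nra.
have [z hz] := rate_cvg cu.
have key x : rinner x z = g x.
  apply/eqP; rewrite -subr_eq0; apply/eqP.
  apply: (@rate_eq0 _ (1 + rnorm x ^+ 2 + 2 * rnorm x)) => n.
  (* First variation: moving from u n along x lowers phi by at most the tolerance. *)
  have var (t : R) : t ^+ 2 * rnorm x ^+ 2 + 2 * t * (rinner x (u n) - g x)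
      + (n.+1%:R^-1) ^+ 2 >= 0.
    have := phi_inf (u n + t%:C *: x); have := hu n.
    rewrite /phi gD gZ !rinnerE rnorm2 (rinnerC (u n) x).
    move: (n.+1%:R^-1) => a; move: (inf A) => m h1 h2.
    move: (rinner x x) (rinner x (u n)) (rinner (u n) (u n)) (g x) (g (u n)) h1 h2.
    by move=> ? ? ? ? ?; lra.
  have h1 : rinner x (u n - z) <= rnorm x * (2 / n.+1%:R).
    by apply: (le_trans (rinner_le _ _)); rewrite ler_wpM2l ?rnorm_ge0.
  have h2 : rinner x (z - u n) <= rnorm x * (2 / n.+1%:R).
    by apply: (le_trans (rinner_le _ _)); rewrite ler_wpM2l ?rnorm_ge0 // rnormBC.
  (* The size 1 / (n + 1) of t balances the linear term against the tolerance; after division by it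
     all remaining errors are of order 1 / (n + 1). *)
  have v1 := var (n.+1%:R^-1); have v2 := var (- n.+1%:R^-1).
  move: h1 h2 v1 v2 (ninv_gt0 n); rewrite !rinnerE.
  move: (n.+1%:R^-1) => a h1 h2 v1 v2 a0.
  have w1 : a * rnorm x ^+ 2 + 2 * (rinner x (u n) - g x) + a >= 0.
    by rewrite -(pmulr_rge0 _ a0); move: v1; congr (_ <= _); ring.
  have w2 : a * rnorm x ^+ 2 - 2 * (rinner x (u n) - g x) + a >= 0.
    by rewrite -(pmulr_rge0 _ a0); move: v2; congr (_ <= _); ring.
  have nx := mulr_ge0 (ltW a0) (sqr_ge0 (rnorm x)).
  by rewrite ler_norml; apply/andP; split; lra.
(* Only real parts agree so far; the vector ix supplies the imaginary parts. *)
exists z => x; have := key ('i *: x); have := key x.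
rewrite rinneriZ /g fZ -complexiE ReM /= mul0r sub0r mul1r.
case: (f x) => a b; case: <[x, z]> => c d /= -> /oppr_inj ->.
by [].
Qed.

Lemma inner_injr y z : (forall x, <[x, y]> = <[x, z]>) -> y = z.
Proof.
move=> h; apply/eqP; rewrite -subr_eq0; apply/eqP/rnorm_eq0/eqP.
by rewrite -sqrf_eq0 rnorm2 innerDr innerNr h subrr.
Qed.

Lemma bounded_pos T : bounded_operator T ->
  exists2 M : R, 0 < M & forall x, rnorm (T x) <= M * rnorm x.
Proof.
case=> _ [M hM]; exists (`|M| + 1); first by rewrite ltr_wpDl.
move=> x; apply: (le_trans (hM x)); apply: ler_wpM2r; first exact: rnorm_ge0.
by apply: (le_trans (ler_norm M)); rewrite lerDl.
Qed.

(** From |Sy|^2 = <TSy, y> <= M |Sy| |y|, after division by |Sy|. *)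
Lemma adjoint_bound T S (M : R) : 0 <= M ->
  (forall x, rnorm (T x) <= M * rnorm x) ->
  (forall x y, <[T x, y]> = <[x, S y]>) ->
  forall y, rnorm (S y) <= M * rnorm y.
Proof.
move=> M0 bT hS y; have [->|ny] := eqVneq (S y) 0.
  by rewrite rnorm0 mulr_ge0 ?rnorm_ge0.
have np : 0 < rnorm (S y).
  rewrite lt_neqAle rnorm_ge0 andbT eq_sym.
  by apply: contra_neq ny => /rnorm_eq0.
rewrite -(ler_pM2l np) -expr2 rnorm2 -hS.
apply: (le_trans (rinner_le _ _)); rewrite mulrCA mulrA.
by apply: ler_wpM2r; rewrite ?rnorm_ge0.
Qed.

(** Riesz applied to x -> <Tx, y> gives Sy; S is linear because a vector is determined by its
    pairings. *)
Lemma adjoint_exists T : bounded_operator T -> exists S, is_adjoint T S.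
Proof.
move=> hT; have [M M0 bT] := bounded_pos hT; have lT := hT.1.
have /choice[S hS] : forall y, exists z, forall x, <[T x, y]> = <[x, z]>.
  move=> y; apply: (@riesz (fun x => <[T x, y]>) (M * rnorm y)).
    by move=> c x z; rewrite lT innerDl innerZl.
  move=> x; apply: (le_trans (rnorm_inner_le _ _)).
  by rewrite mulrAC ler_wpM2r ?rnorm_ge0.
exists S; split; last by move=> x y; rewrite hS.
split; last by exists M; apply: (@adjoint_bound T) => //; rewrite ?ltW.
move=> c x y; apply: inner_injr => w.
by rewrite -hS !(innerDr, innerZr) !hS.
Qed.

Lemma adjointP T : bounded_operator T -> is_adjoint T (adjoint T).
Proof. by move=> hT; have [S hS] := adjoint_exists hT; apply: (xgetPex 0); exists S. Qed.

End Riesz.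

(** * The iteration for the square root of 1 - P *)

Section SquareRoot.
Local Open Scope complex_scope.
Variables (R : realType) (H : hilbertType R).
Implicit Types (x y z : H) (A B P Q S T X : H -> H) (M : R).

(* With Y = 1 - S, the equation S^2 = 1 - P reads Y = (P + Y^2) / 2. *)
Fixpoint root_iter P n : H -> H :=
  if n is m.+1 then
    fun x => (2^-1 : R)%:C *: (P x + root_iter P m (root_iter P m x))
  else fun=> 0.

(* The same recursion with P = 1; it dominates the operator recursion. *)
Fixpoint scalar_iter n : R :=
  if n is m.+1 then 2^-1 * (1 + scalar_iter m ^+ 2) else 0.

Lemma scalar_iter_bounds n : 0 <= scalar_iter n /\ scalar_iter n <= 1.
Proof. by elim: n => [|n [h0 h1]] /=; split; nra. Qed.

Lemma scalar_iter_mono n : scalar_iter n <= scalar_iter n.+1.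
Proof.
rewrite /=; have := sqr_ge0 (1 - scalar_iter n).
by move: (scalar_iter n) => a; nra.
Qed.

(** The gap e to 1 obeys e' = e - e^2 / 2. The induction carries the stronger bound (n + 2) e <= 2,
    an equality at n = 0. *)
Lemma scalar_iter_rate n : 1 - scalar_iter n <= 2 / n.+1%:R.
Proof.
suff : (1 - scalar_iter n) * n.+2%:R <= 2.
  move=> h; rewrite ler_pdivlMr ?ltr0n //; apply: le_trans h.
  apply: ler_wpM2l; last by rewrite ler_nat.
  by rewrite subr_ge0 (scalar_iter_bounds n).2.
elim: n => [|n]; first by rewrite subr0 mul1r.
have [] := scalar_iter_bounds n; rewrite /=.
rewrite -[n.+3]addn1 natrD; have : (2 : R) <= n.+2%:R by rewrite ler_nat.
move: (scalar_iter n) n.+2%:R => a k k2 a0 a1 h.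
have -> : 1 - 2^-1 * (1 + a ^+ 2) = (1 - a) - (1 - a) ^+ 2 / 2 by field.
set e := 1 - a in h *; have e0 : 0 <= e by rewrite subr_ge0.
have e1 : e <= 1 by rewrite /e; lra.
have -> : (e - e ^+ 2 / 2) * (k + 1) = e * k + e - e * (e * k + e) / 2 by field.
have d0 : 0 <= 2 - e * k by rewrite subr_ge0.
(* Half of this product plus e^2 / 2 is exactly the slack of the induction step. *)
have : 0 <= (2 - e * k) * (2 - e) by rewrite mulr_ge0 //; lra.
have : 0 <= e ^+ 2 by exact: sqr_ge0.
by lra.
Qed.

Lemma rate_eq (a b : H) (K : R) :
  (forall n : nat, rnorm (a - b) <= K / n.+1%:R) -> a = b.
Proof.
move=> h; apply/eqP; rewrite -subr_eq0; apply/eqP/rnorm_eq0.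
by apply: (@rate_eq0 _ K) => n; rewrite ger0_norm ?rnorm_ge0.
Qed.

Definition symmetric_op S := forall x y, <[S x, y]> = <[x, S y]>.
Definition contraction S := forall x, rnorm (S x) <= rnorm x.

Lemma root_iter_linear P n : linear P -> linear (root_iter P n).
Proof.
move=> lP; elim: n => [|n IH] c x y /=; first by rewrite scaler0 addr0.
by rewrite lP !IH !scalerDr !scalerA [_ * c]mulrC addrACA.
Qed.

Lemma root_iter_sym P n : symmetric_op P -> symmetric_op (root_iter P n).
Proof.
move=> sP; elim: n => [|n IH] x y /=; first by rewrite inner0l inner0r.
rewrite innerZl innerZr innerDl innerDr sP !IH; congr (_ * _).
by rewrite [RHS]conjc_real.
Qed.

Lemma root_iter_intertwine X P Q n : linear X ->
  (forall x, X (P x) = Q (X x)) ->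
  forall x, X (root_iter P n x) = root_iter Q n (X x).
Proof.
move=> lX h; elim: n => [|n IH] x /=; first by rewrite lin0.
by rewrite linZ // linD // h !IH.
Qed.

Lemma root_iter_le P n x : linear P -> contraction P ->
  rnorm (root_iter P n x) <= scalar_iter n * rnorm x.
Proof.
move=> lP cP; elim: n x => [|n IH] x /=; first by rewrite rnorm0 mul0r.
rewrite rnormZr ?invr_ge0 // -mulrA ler_pM2l ?invr_gt0 //.
apply: (le_trans (rnormD _ _)); rewrite mulrDl mul1r lerD //.
apply: (le_trans (IH _)); rewrite expr2 -mulrA ler_wpM2l //.
exact: (scalar_iter_bounds n).1.
Qed.

(** The splitting Y1 Y1 - Y0 Y0 = Y1 (Y1 - Y0) + (Y1 - Y0) Y0 mirrors y1^2 - y0^2 = (y1 - y0)(y1 +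
    y0), so scalar increments dominate operator increments. *)
Lemma root_iter_step P n x : linear P -> contraction P ->
  rnorm (root_iter P n.+1 x - root_iter P n x) <=
  (scalar_iter n.+1 - scalar_iter n) * rnorm x.
Proof.
move=> lP cP; elim: n x => [|n IH] x.
  rewrite /= subr0 addr0 rnormZr ?invr_ge0 // expr0n addr0 mulr1 subr0.
  by rewrite ler_pM2l ?invr_gt0.
have lY k := root_iter_linear k lP.
set Y1 := root_iter P n.+1 in IH lY *; set Y0 := root_iter P n in IH *.
set y1 := scalar_iter n.+1 in IH *; set y0 := scalar_iter n in IH *.
have -> : root_iter P n.+2 x - Y1 x =
  (2^-1 : R)%:C *: (Y1 (Y1 x - Y0 x) + (Y1 (Y0 x) - Y0 (Y0 x))).
  have E2 : root_iter P n.+2 x = (2^-1 : R)%:C *: (P x + Y1 (Y1 x)) by [].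
  have E1 : Y1 x = (2^-1 : R)%:C *: (P x + Y0 (Y0 x)) by [].
  rewrite (linB _ _ (lY n.+1 : linear Y1)) addrA subrK E2 {2}E1.
  by rewrite -scalerBr opprD addrACA subrr add0r.
have -> : scalar_iter n.+2 - y1 = 2^-1 * ((y1 - y0) * (y1 + y0)).
  have E2 : scalar_iter n.+2 = 2^-1 * (1 + y1 ^+ 2) by [].
  have E1 : y1 = 2^-1 * (1 + y0 ^+ 2) by [].
  by rewrite E2 {2}E1; field.
rewrite rnormZr ?invr_ge0 // -mulrA ler_pM2l ?invr_gt0 // mulrAC mulrDr.
apply: (le_trans (rnormD _ _)); apply: lerD.
  apply: (le_trans (root_iter_le _ _ lP cP)); rewrite -/y1.
  rewrite [leRHS]mulrC ler_wpM2l // (scalar_iter_bounds n.+1).1 //.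
apply: (le_trans (IH _)); rewrite -mulrA.
apply: ler_wpM2l; first by rewrite subr_ge0 scalar_iter_mono.
by rewrite mulrC; apply: (le_trans (root_iter_le _ _ lP cP)); rewrite mulrC.
Qed.

(** Operator increments telescope against the scalar ones, whose sum from n on is at most the gap 1
    - [scalar_iter n]. *)
Lemma root_iter_cauchy P n m x : linear P -> contraction P -> (n <= m)%N ->
  rnorm (root_iter P m x - root_iter P n x) <= 2 * rnorm x / n.+1%:R.
Proof.
move=> lP cP nm.
suff h : rnorm (root_iter P m x - root_iter P n x) <=
    (scalar_iter m - scalar_iter n) * rnorm x.
  apply: (le_trans h); rewrite mulrAC ler_wpM2r ?rnorm_ge0 //.
  apply: le_trans (scalar_iter_rate n); rewrite lerD2r.
  exact: (scalar_iter_bounds m).2.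
rewrite -(subnK nm); elim: (m - n)%N => [|k IH].
  by rewrite add0n !subrr rnorm0 mul0r.
rewrite addSn -(subrKA (root_iter P (k + n) x)).
apply: (le_trans (rnormD _ _)).
have -> : scalar_iter (k + n).+1 - scalar_iter n =
  (scalar_iter (k + n).+1 - scalar_iter (k + n))
  + (scalar_iter (k + n) - scalar_iter n) by rewrite subrKA.
by rewrite mulrDl; apply: lerD => //; exact: root_iter_step.
Qed.

(** The limit is chosen by its rate, which determines it uniquely; the default 0 is returned only
    when no vector satisfies the rate. *)
Definition root_lim P x : H :=
  xget 0 [set l | forall n : nat,
    rnorm (root_iter P n x - l) <= 2 * rnorm x / n.+1%:R]%classic.

Lemma root_lim_rate P x : linear P -> contraction P -> forall n : nat,
  rnorm (root_iter P n x - root_lim P x) <= 2 * rnorm x / n.+1%:R.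
Proof.
move=> lP cP.
have [l hl] := rate_cvg (fun n m nm => root_iter_cauchy x lP cP nm).
exact: (@xgetPex H 0 [set l | forall n : nat,
  rnorm (root_iter P n x - l) <= 2 * rnorm x / n.+1%:R]%classic
  (ex_intro _ l hl)).
Qed.

Lemma root_lim_linear P : linear P -> contraction P -> linear (root_lim P).
Proof.
move=> lP cP c x y.
pose w := c *: x + y.
apply: (@rate_eq _ _ (2 * rnorm w + rnorm c * (2 * rnorm x) + 2 * rnorm y)) => n.
have hw := root_lim_rate w lP cP n.
have hx := root_lim_rate x lP cP n.
have hy := root_lim_rate y lP cP n.
set Y := root_lim P in hw hx hy *; set Yn := root_iter P n in hw hx hy.
have -> : Y w - (c *: Y x + Y y) =
   (Y w - Yn w) + (c *: (Yn x - Y x) + (Yn y - Y y)).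
  rewrite /Yn /w (root_iter_linear n lP) -/Yn scalerBr.
  rewrite [X in _ = _ + X]addrACA -opprD.
  by rewrite [RHS]addrA subrK.
apply: (le_trans (rnormD _ _)); rewrite 2!(mulrDl _ _ n.+1%:R^-1) -addrA.
apply: lerD; first by rewrite rnormBC.
apply: (le_trans (rnormD _ _)); apply: lerD => //.
by rewrite rnormZ -mulrA ler_wpM2l ?rnormc_ge0.
Qed.

Lemma root_lim_contraction P : linear P -> contraction P ->
  contraction (root_lim P).
Proof.
move=> lP cP x; apply: (@rate_le _ (2 * rnorm x)) => n.
rewrite -[root_lim P x](subrK (root_iter P n x)).
apply: (le_trans (rnormD _ _)); rewrite addrC; apply: lerD.
  apply: (le_trans (root_iter_le n x lP cP)).
  rewrite -[leRHS]mul1r ler_wpM2r ?rnorm_ge0 //.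
  exact: (scalar_iter_bounds n).2.
by rewrite rnormBC; apply: root_lim_rate.
Qed.

Lemma root_lim_sym P : linear P -> contraction P -> symmetric_op P ->
  symmetric_op (root_lim P).
Proof.
move=> lP cP sP x y; apply/eqP; rewrite -subr_eq0; apply/eqP/rnormc_eq0.
apply: (@rate_eq0 _ (4 * rnorm x * rnorm y)) => n.
have -> : <[root_lim P x, y]> - <[x, root_lim P y]> =
  <[root_lim P x - root_iter P n x, y]> + <[x, root_iter P n y - root_lim P y]>.
  rewrite innerDl innerDr innerNl innerNr (root_iter_sym n sP).
  by rewrite addrA subrK.
rewrite ger0_norm ?rnormc_ge0 //.
apply: (le_trans (rnormcD _ _)).
have h1 := root_lim_rate x lP cP n; have h2 := root_lim_rate y lP cP n.
have e1 := rnorm_inner_le (root_lim P x - root_iter P n x) y.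
have e2 := rnorm_inner_le x (root_iter P n y - root_lim P y).
rewrite rnormBC in e1.
have e3 := ler_wpM2r (rnorm_ge0 y) h1; have e4 := ler_wpM2l (rnorm_ge0 x) h2.
apply: (le_trans (lerD (le_trans e1 e3) (le_trans e2 e4))).
by rewrite le_eqVlt; apply/orP; left; apply/eqP; ring.
Qed.

(** The limit of P = 2 Y_{n+1} - Y_n^2. For S = 1 - Y it says S^2 = 1 - P. *)
Lemma root_lim_eq P x : linear P -> contraction P ->
  root_lim P (root_lim P x) = (2 : R)%:C *: root_lim P x - P x.
Proof.
move=> lP cP; set Y := root_lim P.
apply: (@rate_eq _ _ (2 * rnorm x + 2 * rnorm (Y x) + 4 * rnorm x)) => n.
have h1 := root_lim_rate x lP cP n; have h2 := root_lim_rate (Y x) lP cP n.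
have h3 := root_lim_rate x lP cP n.+1; rewrite -/Y in h1 h2 h3.
have e : P x = (2 : R)%:C *: root_iter P n.+1 x
    - root_iter P n (root_iter P n x).
  rewrite /= scalerA -rmorphM /= divff // scale1r addrK //.
set Yn := root_iter P n in h1 h2 e *; set Z := root_iter P n.+1 in h3 e *.
have -> : Y (Y x) - ((2 : R)%:C *: Y x - P x) =
  ((Y (Y x) - Yn (Y x)) + Yn (Y x - Yn x)) + (2 : R)%:C *: (Z x - Y x).
  rewrite e (linB _ _ (root_iter_linear n lP : linear Yn)) addrA subrK.
  by rewrite scalerBr !opprB -!addrA; congr (_ + _); rewrite addrCA.
rewrite (_ : _ / _ = 2 * rnorm (Y x) / n.+1%:R + 2 * rnorm x / n.+1%:R
   + 2 * (2 * rnorm x / n.+1%:R)); last by ring.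
apply: (le_trans (rnormD _ _)); apply: lerD.
  apply: (le_trans (rnormD _ _)); apply: lerD; first by rewrite rnormBC.
  apply: (le_trans (root_iter_le _ _ lP cP)); rewrite rnormBC.
  apply: le_trans h1; rewrite -[leRHS]mul1r ler_wpM2r ?rnorm_ge0 //.
  exact: (scalar_iter_bounds n).2.
rewrite rnormZr // ler_pM2l //; apply: (le_trans h3).
apply: ler_wpM2l; first by rewrite mulr_ge0 ?rnorm_ge0.
by rewrite lef_pV2 ?posrE ?ltr0n // ler_nat.
Qed.

(** Each iterate intertwines, and boundedness of X carries the rate through. Two maps P and Q are
    allowed because T relates T*T to TT*. *)
Lemma root_lim_intertwine X P Q : bounded_operator X ->
  linear P -> contraction P -> linear Q -> contraction Q ->
  (forall x, X (P x) = Q (X x)) ->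
  forall x, X (root_lim P x) = root_lim Q (X x).
Proof.
move=> hX lP cP lQ cQ h x; have lX := hX.1; have [M M0 bX] := bounded_pos hX.
apply: (@rate_eq _ _ (M * (2 * rnorm x) + 2 * rnorm (X x))) => n.
have -> : X (root_lim P x) - root_lim Q (X x) =
  X (root_lim P x - root_iter P n x)
  + (root_iter Q n (X x) - root_lim Q (X x)).
  by rewrite (linB _ _ lX) (root_iter_intertwine n lX h) addrA subrK.
apply: (le_trans (rnormD _ _)); rewrite (mulrDl _ _ n.+1%:R^-1).
apply: lerD; last exact: root_lim_rate.
apply: (le_trans (bX _)); rewrite -mulrA ler_pM2l // rnormBC.
exact: root_lim_rate.
Qed.

End SquareRoot.

(** * Positive square roots, absolute values and the mixed Schwarz inequality *)

Section AbsoluteValue.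
Local Open Scope complex_scope.
Variables (R : realType) (H : hilbertType R).
Implicit Types (x y z : H) (A B P Q S T X : H -> H) (M : R).

(** The map P with 1 - P = A / M^2, so that M (1 - Y) squares to A. *)
Definition root_shift M A x : H := x - (M ^- 2)%:C *: A x.

(** The contraction condition encodes positivity: <Ax, x> / M^2 = |x|^2 - <Px, x> >= 0. *)
Definition rootable M A :=
  [/\ 0 < M, linear A, symmetric_op A & contraction (root_shift M A)].

Definition root M A x : H := M%:C *: (x - root_lim (root_shift M A) x).

Lemma root_shift_linear M A : linear A -> linear (root_shift M A).
Proof.
move=> lA c x y; rewrite /root_shift lA !scalerDr scalerN !scalerA [_ * c]mulrC.
by rewrite opprD addrACA.
Qed.

Lemma root_shift_sym M A : symmetric_op A -> symmetric_op (root_shift M A).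
Proof.
move=> sA x y; rewrite innerDl innerDr innerNl innerNr innerZl innerZr sA.
by rewrite [X in _ = _ - X * _]conjc_real.
Qed.

Lemma root_linear M A : rootable M A -> linear (root M A).
Proof.
case=> M0 lA sA cA c x y; have lP := root_shift_linear M lA.
rewrite /root (root_lim_linear lP cA) opprD addrACA -scalerBr scalerDr.
by rewrite !scalerA mulrC.
Qed.

(** The limit Y is a symmetric contraction, so <x - Yx, x> is real and at least |x|^2 - |x|^2 =
    0. *)
Lemma root_positive M A : rootable M A -> positive_operator (root M A).
Proof.
move=> rA; split; last first.
  move=> x; case: rA => M0 lA sA cA; have lP := root_shift_linear M lA.
  have sY := root_lim_sym lP cA (root_shift_sym M sA).
  have cY := root_lim_contraction lP cA.
  rewrite /root innerZl mulr_ge0 ?ler0c ?(ltW M0) // lecE; apply/andP; split.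
    rewrite innerDl innerNl ImD ImN inner_xx /= sub0r oppr_eq0.
    by have := iminnerC (root_lim (root_shift M A) x) x; rewrite sY => h;
      apply/eqP; lra.
  rewrite /= rinnerDl rinnerNl subr_ge0 -rnorm2.
  apply: (le_trans (rinner_le _ _)); rewrite expr2 ler_wpM2r ?rnorm_ge0 //.
split; first exact: root_linear.
case: rA => M0 lA sA cA; have lP := root_shift_linear M lA.
exists (M * 2) => x; rewrite rnormZr ?(ltW M0) // -mulrA ler_pM2l //.
apply: (le_trans (rnormB _ _)); have := root_lim_contraction lP cA x.
by move=> h; lra.
Qed.

Lemma root_sqr M A x : rootable M A -> root M A (root M A x) = A x.
Proof.
move=> rA; have lS := root_linear rA; case: rA => M0 lA sA cA.
have lP := root_shift_linear M lA; have lY := root_lim_linear lP cA.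
have nM : M != 0 by rewrite gt_eqF.
set Y := root_lim _ in lY.
have -> : root M A x = M%:C *: (x - Y x) by [].
have eY : Y (Y x) = (2 : R)%:C *: Y x - root_shift M A x := root_lim_eq x lP cA.
rewrite linZ // /root -/Y (linB _ _ lY) eY.
(* This is 1 - 2Y + Y^2 = 1 - P. *)
have -> : x - Y x - (Y x - ((2 : R)%:C *: Y x - root_shift M A x)) =
    (M ^- 2)%:C *: A x.
  rewrite rmorphD /= scalerDl scale1r /root_shift.
  move: (Y x) (_ *: A x) => b c.
  rewrite (opprB (b + b)) [b + _]addrCA.
  have -> : b - (b + b) = - b by rewrite opprD addrA subrr sub0r.
  by rewrite opprB addrA subrK opprB addrC subrK.
have h1 : M * M * M ^- 2 = 1 by rewrite -expr2 mulfV ?expf_neq0.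
by rewrite !scalerA -!rmorphM ?mulrA h1 scale1r.
Qed.

Lemma root_intertwine M A B X x : rootable M A -> rootable M B ->
  bounded_operator X -> (forall y, X (A y) = B (X y)) ->
  X (root M A x) = root M B (X x).
Proof.
move=> [M0 lA _ cA] [_ lB _ cB] bX h; have lX := bX.1.
rewrite /root linZ // linB //; congr (_ *: (_ - _)).
apply: root_lim_intertwine => //; try exact: root_shift_linear.
by move=> y; rewrite /root_shift linB // linZ // h.
Qed.

(** With c = M^-2, |x - cSTx|^2 = |x|^2 - 2c |Tx|^2 + c^2 |STx|^2, and c |STx|^2 <= |Tx|^2 since S
    inherits the bound M. *)
Lemma gram_rootable T S M : 0 < M -> linear T -> linear S ->
  (forall x, rnorm (T x) <= M * rnorm x) ->
  (forall x y, <[T x, y]> = <[x, S y]>) -> rootable M (S \o T).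
Proof.
move=> M0 lT lS bT hS; have bS := adjoint_bound (ltW M0) bT hS.
have hT x y : <[S x, y]> = <[x, T y]>.
  by rewrite inner_conj -hS -inner_conj.
split => //; first exact: lin_comp.
  by move=> x y /=; rewrite hT hS.
move=> x; rewrite -ler_sqr ?nnegrE ?rnorm_ge0 // !rnorm2 /root_shift /=.
have h1 : rinner (S (T x)) x = rinner (T x) (T x) by rewrite hT.
have h2 : rinner x (S (T x)) = rinner (T x) (T x) by rewrite -hS.
rewrite !rinnerE h1 h2 -(rnorm2 (S (T x))) -(rnorm2 (T x)).
have h3 : rnorm (S (T x)) ^+ 2 <= M ^+ 2 * rnorm (T x) ^+ 2.
  by rewrite -exprMn ler_sqr ?nnegrE ?mulr_ge0 ?rnorm_ge0 ?(ltW M0).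
have c0 : 0 < M ^- 2 by rewrite invr_gt0 exprn_gt0.
have h4 : M ^- 2 * rnorm (S (T x)) ^+ 2 <= rnorm (T x) ^+ 2.
  by rewrite mulrC ler_pdivrMr ?exprn_gt0 // mulrC.
have h5 := sqr_ge0 (rnorm (T x)).
move: (rnorm (T x) ^+ 2) (rnorm (S (T x)) ^+ 2) (M ^- 2) (rinner x x) c0 h4 h5.
move=> t s c n c0 h4 h5.
have : c * (c * s) <= c * t by rewrite ler_pM2l.
have : 0 <= c * t by rewrite mulr_ge0 // ltW.
by lra.
Qed.

(** Schwarz for the form of S, with y = Sx, gives |Sx|^4 <= 0. *)
Lemma positive_kernel S x : linear S -> (forall x, 0 <= <[S x, x]>) ->
  rinner (S x) x = 0 -> S x = 0.
Proof.
move=> lS pS h; apply: rnorm_eq0; apply/eqP.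
have := schwarz_form x (S x) lS pS; rewrite h mul0r -rnorm2.
by rewrite real_exprn_even_le0 ?num_real //= sqrf_eq0.
Qed.

(** For y = Sx - S'x, commutation gives (S + S')y = 0. The forms of S and S' then both vanish at y,
    so Sy = S'y = 0, and symmetry gives |y|^2 = <x, Sy> - <x, S'y> = 0. *)
Lemma commuting_roots_eq S S' : positive_operator S -> positive_operator S' ->
  (forall x, S (S x) = S' (S' x)) -> (forall x, S (S' x) = S' (S x)) -> S = S'.
Proof.
move=> [[lS _] pS] [[lS' _] pS'] sq co; apply/funext => x; apply/eqP.
rewrite -subr_eq0; apply/eqP/rnorm_eq0/eqP; set y := S x - S' x.
have e : S y + S' y = 0.
  by rewrite /y (linB _ _ lS) (linB _ _ lS') sq co addrA subrK subrr.
have q U : (forall z, 0 <= <[U z, z]>) -> 0 <= rinner (U y) y.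
  by move=> /(_ y); rewrite lecE => /andP[].
have : rinner (S y) y + rinner (S' y) y = 0 by rewrite -rinnerDl e inner0l.
have := q _ pS; have := q _ pS'; move=> q1 q2 q3.
have k1 : S y = 0 by apply: positive_kernel => //; lra.
have k2 : S' y = 0 by apply: positive_kernel => //; lra.
rewrite -sqrf_eq0 rnorm2 {1}/y rinnerDl rinnerNl.
by rewrite !(positive_symmetric lS pS, positive_symmetric lS' pS') k1 k2 !inner0r subrr.
Qed.

(** A root S commutes with A = S^2, hence with [root M A], and the commuting case applies. *)
Lemma root_unique M A S : rootable M A -> positive_operator S ->
  (forall x, S (S x) = A x) -> S = root M A.
Proof.
move=> rA pS hS; have pR := root_positive rA.
apply: commuting_roots_eq => // x; first by rewrite hS root_sqr.
by apply: root_intertwine => //; [exact: pS.1|move=> y; rewrite -!hS].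
Qed.

(** Any bound M of T may serve in the explicit root, which allows a common M for T and its
    adjoint. *)
Lemma abs_operatorE T M : 0 < M -> bounded_operator T ->
  (forall x, rnorm (T x) <= M * rnorm x) ->
  rootable M (adjoint T \o T) /\ abs_operator T = root M (adjoint T \o T).
Proof.
move=> M0 hT bT; have [[lS _] hS] := adjointP hT.
have rA := gram_rootable M0 hT.1 lS bT hS; split=> //.
have /(xgetPex 0)[pS eS] : exists S, positive_operator S /\ S \o S = adjoint T \o T.
  exists (root M (adjoint T \o T)); split; first exact: root_positive.
  by apply/funext => x; exact: root_sqr.
by apply: root_unique => // x; move/(congr1 (@^~ x)): eS.
Qed.

Lemma adjointK T : bounded_operator T -> adjoint (adjoint T) = T.
Proof.
move=> hT; have [bS hS] := adjointP hT; have [_ h] := adjointP bS.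
apply/funext => y; apply: inner_injr => x.
by rewrite -h inner_conj -hS -inner_conj.
Qed.

Lemma abs_operator_spec T : bounded_operator T ->
  let A := abs_operator T in let B := abs_operator (adjoint T) in
  [/\ positive_operator A, positive_operator B,
      forall x, A (A x) = adjoint T (T x), forall x, B (B x) = T (adjoint T x)
    & forall x, T (A x) = B (T x)].
Proof.
move=> hT /=; have [M M0 bT] := bounded_pos hT.
have [bS hS] := adjointP hT; have bS' := adjoint_bound (ltW M0) bT hS.
have [rA ->] := abs_operatorE M0 hT bT.
have [rB ->] := abs_operatorE M0 bS bS'; rewrite adjointK // in rB *.
split; try exact: root_positive.
- by move=> x; rewrite root_sqr.
- by move=> x; rewrite root_sqr.
(* T intertwines T*T with TT*, and both roots are taken with the same M. *)
- by move=> x; apply: root_intertwine.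
Qed.

(** Take u almost minimising |x - Au|^2. The residual itself need not be small, but its image under
    A is, which is density of the range modulo the kernel. *)
Lemma range_approx A : positive_operator A -> exists2 K : R, 0 < K &
  forall x (n : nat), exists u, rnorm (A (x - A u)) <= K / n.+1%:R /\
    rnorm (A u) <= 2 * rnorm x + 1.
Proof.
move=> [hA pA]; have [K K0 bA] := bounded_pos hA; have lA := hA.1.
exists K => // x n; pose E := [set rnorm (x - A u) ^+ 2 | u in [set: H]]%classic.
have hE : has_inf E.
  split; first by exists (rnorm (x - A 0) ^+ 2), 0.
  by exists 0 => _ [u _ <-]; exact: sqr_ge0.
have infE u : inf E <= rnorm (x - A u) ^+ 2.
  by apply: ge_inf; [exact: hE.2|exists u].
have d0 : (0 : R) < n.+1%:R^-1 ^+ 2 by rewrite exprn_gt0 // invr_gt0 ltr0n.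
have [_ [u _ <-] hu] := inf_adherent d0 hE; exists u.
set w := x - A u in hu *; have ew : w = x - A u by []; clearbody w.
set d := n.+1%:R^-1 in d0 hu *.
have dp : 0 < d by rewrite invr_gt0 ltr0n.
have d1 : d <= 1 by rewrite invf_le1 ?ltr0n // ler1n.
split.
  (* A gradient step from u: with w the residual, it lowers |w|^2 by at least K^-2 |Aw|^2, while at
     most d^2 can be gained. *)
  have := infE (u + (K ^- 2)%:C *: A w).
  have -> : x - A (u + (K ^- 2)%:C *: A w) = w - (K ^- 2)%:C *: A (A w).
    by rewrite linD // linZ // opprD addrA -ew.
  rewrite rnorm2 !rinnerE (rinnerC w (A (A w))).
  have -> : rinner (A (A w)) w = rnorm (A w) ^+ 2.
    by rewrite rnorm2 (positive_symmetric lA pA (A w) w).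
  rewrite -(rnorm2 w) -(rnorm2 (A (A w))).
  have h4 : K ^- 2 * rnorm (A (A w)) ^+ 2 <= rnorm (A w) ^+ 2.
    rewrite mulrC ler_pdivrMr ?exprn_gt0 // mulrC -exprMn.
    by rewrite ler_sqr ?nnegrE ?mulr_ge0 ?rnorm_ge0 ?(ltW K0).
  have c0 : 0 < K ^- 2 by rewrite invr_gt0 exprn_gt0.
  have h5 : K ^- 2 * (K ^- 2 * rnorm (A (A w)) ^+ 2) <= K ^- 2 * rnorm (A w) ^+ 2.
    by rewrite ler_pM2l.
  move=> h6.
  have h7 : K ^- 2 * rnorm (A w) ^+ 2 <= d ^+ 2 by move: h5 h6 hu; nra.
  rewrite -ler_sqr ?nnegrE ?rnorm_ge0 ?mulr_ge0 ?(ltW K0) ?(ltW dp) //.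
  by rewrite exprMn mulrC -ler_pdivrMr ?exprn_gt0 // mulrC.
have wx : rnorm w <= rnorm x + 1.
  have x0 := rnorm_ge0 x.
  rewrite -ler_sqr ?nnegrE ?rnorm_ge0 ?addr_ge0 //.
  (* Comparison with u = 0 gives |w|^2 <= |x|^2 + d^2 <= (|x| + 1)^2. *)
  have := infE 0; rewrite lin0 // subr0; nra.
have -> : A u = x - w by rewrite ew opprB addrC subrK.
by apply: (le_trans (rnormB _ _)); lra.
Qed.

Lemma mixed_schwarz T : bounded_operator T -> forall x y,
  rnorm <[T x, y]> ^+ 2 <=
  rinner (abs_operator T x) x * rinner (abs_operator (adjoint T) y) y.
Proof.
move=> hT x y; have [pA pB eA eB eT] := abs_operator_spec hT.
have [_ hS] := adjointP hT; have lT := hT.1.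
set A := abs_operator T in pA eA eT *; set B := abs_operator _ in pB eB eT *.
have lA := pA.1.1; have sA := positive_symmetric lA pA.2.
have core u : rnorm <[T (A u), y]> ^+ 2 <= rinner (A (A u)) (A u) * rinner (B y) y.
  rewrite eT; have := schwarz_form_norm (T u) y pB.1.1 pB.2.
  suff -> : rinner (B (T u)) (T u) = rinner (A (A u)) (A u) by [].
  by rewrite -eT hS -eA -sA.
(* Thus T nearly kills the residual whenever A does. *)
have TA z : rnorm (T z) = rnorm (A z).
  apply/eqP; rewrite -(eqrXn2 (n := 2)) ?rnorm_ge0 // !rnorm2.
  by rewrite hS -eA -sA.
have [K K0 apx] := range_approx pA.
have b0 : 0 <= rinner (B y) y by have := pB.2 y; rewrite lecE => /andP[].
set p := rnorm <[T x, y]>; set a := rinner (A x) x.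
set b := rinner (B y) y in core b0 *.
pose c := 3 * rnorm x + 1.
(* With e = K / (n + 1) <= K: the term c b comes from replacing <AAu, Au> by <Ax, x>, the rest from
   replacing |<TAu, y>|^2 by |<Tx, y>|^2. Here c = |x| + (2 |x| + 1). *)
apply: (@rate_le _ (K * (c * b + rnorm y * (2 * p + 3 * K * rnorm y)))) => n.
have [u [h1 h2]] := apx x n.
have := core u; set q := rnorm <[T (A u), y]> => hq.
set w := x - A u in h1.
have hw : rnorm <[T w, y]> <= K / n.+1%:R * rnorm y.
  apply: (le_trans (rnorm_inner_le _ _)).
  by rewrite TA ler_wpM2r ?rnorm_ge0.
have xw : x = A u + w by rewrite /w addrC subrK.
have pq : p <= q + K / n.+1%:R * rnorm y.
  rewrite /p [X in T X]xw linD // innerDl.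
  by apply: (le_trans (rnormcD _ _)); rewrite lerD2l.
have qp : q <= p + K / n.+1%:R * rnorm y.
  have -> : q = rnorm (<[T x, y]> - <[T w, y]>).
    by rewrite -innerNl -innerDl -(linB _ _ lT) {1}xw addrK.
  apply: (le_trans (rnormcD _ _)); rewrite lerD2l.
  by rewrite normrN.
have haq : rinner (A (A u)) (A u) <= a + K / n.+1%:R * c.
  have -> : rinner (A (A u)) (A u) = a + rinner x (- A w) + rinner (- A w) (A u).
    have e1 : A (A u) = A x - A w by rewrite /w linB // opprB addrC subrK.
    have e2 : A u = x - w by rewrite /w opprB addrC subrK.
    have e3 : rinner (A x) w = rinner x (A w) by rewrite sA.
    rewrite e1 [in LHS]rinnerDl; congr (_ + _).
    by rewrite e2 rinnerDr !rinnerNr e3.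
  have e1 := rinner_le x (- A w); have e2 := rinner_le (- A w) (A u).
  rewrite !rnormN in e1 e2.
  have e3 := ler_wpM2l (rnorm_ge0 x) h1.
  have e4 := ler_pM (rnorm_ge0 _) (rnorm_ge0 _) h1 h2.
  move: e1 e2 e3 e4; rewrite /c; move: (K / n.+1%:R) => e; nra.
have q0 : 0 <= q by exact: rnormc_ge0.
have p0 : 0 <= p by exact: rnormc_ge0.
have Y0 := rnorm_ge0 y; have c0 : 0 <= c by rewrite /c addr_ge0 ?mulr_ge0 ?rnorm_ge0.
have -> : a * b + K * (c * b + rnorm y * (2 * p + 3 * K * rnorm y)) / n.+1%:R =
  a * b + (K / n.+1%:R) * (c * b + rnorm y * (2 * p + 3 * K * rnorm y)) by ring.
have e0 : 0 < K / n.+1%:R by rewrite divr_gt0 ?ltr0n.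
have eK : K / n.+1%:R <= K by rewrite ler_pdivrMr ?ltr0n // ler_peMr ?ler1n ?(ltW K0).
move: (K / n.+1%:R) (rnorm y) e0 eK Y0 pq qp haq => e Y e0 eK Y0 pq qp haq.
clear - p0 q0 Y0 e0 eK pq qp haq hq b0 c0.
have s1 : p ^+ 2 <= (q + e * Y) ^+ 2.
  by rewrite ler_sqr ?nnegrE // addr_ge0 // mulr_ge0 // ltW.
have s2 : q ^+ 2 <= (a + e * c) * b by apply: (le_trans hq); rewrite ler_wpM2r.
have eY : 0 <= e * Y by rewrite mulr_ge0 // ltW.
have s3 : e * Y * q <= e * Y * (p + e * Y) by rewrite ler_wpM2l.
have s4 : e * Y * (Y * e) <= e * Y * (Y * K) by rewrite !ler_wpM2l.
lra.
Qed.

End AbsoluteValue.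

(** * Suprema, Buzano's inequality and the estimate at a unit vector *)

Section Suprema.
Local Open Scope complex_scope.
Variables (R : realType) (H : hilbertType R).
Implicit Types (x y z : H) (A B S T : H -> H).

(** A bound in this form passes through sums, multiples and composites, and makes the suprema below
    finite. *)
Definition norm_bounded S :=
  exists2 M : R, 0 <= M & forall x, rnorm (S x) <= M * rnorm x.

Lemma bounded_operator_norm S : bounded_operator S -> norm_bounded S.
Proof. by move=> hS; have [M M0 bS] := bounded_pos hS; exists M; rewrite ?ltW. Qed.

Lemma norm_boundedD S T :
  norm_bounded S -> norm_bounded T -> norm_bounded (S + T).
Proof.
move=> [M M0 bS] [N N0 bT]; exists (M + N); first exact: addr_ge0.
by move=> x; apply: (le_trans (rnormD _ _)); rewrite mulrDl lerD.
Qed.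

Lemma norm_boundedZ c S : norm_bounded S -> norm_bounded (c *: S).
Proof.
move=> [M M0 bS]; exists (rnorm c * M); first by rewrite mulr_ge0 ?rnormc_ge0.
move=> x; have -> : (c *: S) x = c *: S x by [].
by rewrite rnormZ -mulrA; apply: ler_wpM2l; rewrite ?rnormc_ge0.
Qed.

Lemma norm_bounded_comp S T :
  norm_bounded S -> norm_bounded T -> norm_bounded (S \o T).
Proof.
move=> [M M0 bS] [N N0 bT]; exists (M * N); first exact: mulr_ge0.
move=> x /=; apply: (le_trans (bS _)).
by rewrite -mulrA; apply: ler_wpM2l.
Qed.

Lemma numerical_radius_ge S x : norm_bounded S -> rnorm x = 1 ->
  rnorm <[S x, x]> <= numerical_radius S.
Proof.
move=> [M M0 bS] x1; apply: ub_le_sup; last by exists x.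
exists M => _ [y /= y1 <-]; apply: (le_trans (rnorm_inner_le _ _)).
by have := bS y; rewrite y1 !mulr1.
Qed.

Lemma operator_norm_ge S x : norm_bounded S -> rnorm x <= 1 ->
  rnorm (S x) <= operator_norm S.
Proof.
move=> [M M0 bS] x1; apply: ub_le_sup; last by exists x.
exists M => _ [y /= y1 <-]; apply: (le_trans (bS y)).
by rewrite -[leRHS]mulr1; apply: ler_wpM2l.
Qed.

Lemma operator_norm_ge0 S : norm_bounded S -> 0 <= operator_norm S.
Proof.
move=> bS; apply: le_trans (@operator_norm_ge S 0 bS _); first exact: rnorm_ge0.
by rewrite rnorm0.
Qed.

(* The reflection 2 <x, v> x - v has the norm of v. *)
Lemma buzano u v x : rnorm x = 1 ->
  2 * (rinner u x * rinner v x) <= rinner u v + rnorm u * rnorm v.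
Proof.
move=> x1; pose w := (2 * rinner v x)%:C *: x - v.
have nw : rnorm w = rnorm v.
  apply/eqP; rewrite -(eqrXn2 (n := 2)) ?rnorm_ge0 // !rnorm2 /w !rinnerE.
  by rewrite -(rnorm2 x) x1 (rinnerC x v); apply/eqP; ring.
have := rinner_le u w; rewrite nw /w !rinnerE.
by lra.
Qed.

(** Each supremum on the right dominates its value at the same x, which leaves a real inequality in
    a, b, |Ax|, |Bx| and Re <Ax, Bx>. *)
Lemma alpha_norm_pointwise T alpha x : bounded_operator T ->
  0 <= alpha -> alpha <= 1 -> rnorm x = 1 ->
  forall absT absTs, absT = abs_operator T -> absTs = abs_operator (adjoint T) ->
  alpha * rnorm <[T x, x]> ^+ 2 + (1 - alpha) * rnorm (T x) ^+ 2 <=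
    alpha / 4 * numerical_radius (absT + 'i%R *: absTs) ^+ 2
    + alpha / 4 * numerical_radius (absT \o absTs)
    + operator_norm ((1 - 7 * alpha / 8)%:C *: (absT \o absT)
                     + (alpha / 8)%:C *: (absTs \o absTs)).
Proof.
move=> hT h0 h1 x1; have ms := mixed_schwarz hT x x.
have [pA pB eA eB _] := abs_operator_spec hT; have [_ hS] := adjointP hT.
move=> A B defA defB; rewrite -defA -defB in ms pA pB eA eB.
have sA := positive_symmetric pA.1.1 pA.2.
have sB := positive_symmetric pB.1.1 pB.2.
have bA := bounded_operator_norm pA.1; have bB := bounded_operator_norm pB.1.
set a := rinner (A x) x in ms *; set b := rinner (B x) x in ms *.
have nT : rnorm (T x) ^+ 2 = rnorm (A x) ^+ 2.
  by rewrite !rnorm2 hS -eA -sA.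
set W1 := numerical_radius (A + _); set W2 := numerical_radius (A \o B).
set N := operator_norm _.
have hW1 : a ^+ 2 + b ^+ 2 <= W1 ^+ 2.
  have bAB := norm_boundedD bA (norm_boundedZ 'i%R bB).
  have := numerical_radius_ge bAB x1.
  rewrite -/W1 -ler_sqr ?nnegrE ?rnormc_ge0 //; last first.
    by apply: le_trans (numerical_radius_ge bAB x1); exact: rnormc_ge0.
  rewrite rnorm_sqr; have -> : (A + 'i%R *: B) x = A x + 'i%R *: B x by [].
  have iA : complex.Im <[A x, x]> = 0 by exact: ger0_Im (pA.2 x).
  have iB : complex.Im <[B x, x]> = 0 by exact: ger0_Im (pB.2 x).
  rewrite innerDl innerZl -complexiE ReD ImD ReM ImM /= iA iB -/a -/b.
  by rewrite !mul0r !mul1r subrr addr0 !add0r.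
have hW2 : rinner (A x) (B x) <= W2.
  apply: le_trans (numerical_radius_ge (norm_bounded_comp bA bB) x1).
  by rewrite /= rinnerC -sA; apply: Re_le_rnorm.
have hN : (1 - 7 * alpha / 8) * rnorm (A x) ^+ 2
    + alpha / 8 * rnorm (B x) ^+ 2 <= N.
  set C := _ + _ in N *.
  have bC : norm_bounded C.
    by apply: norm_boundedD; apply: norm_boundedZ; apply: norm_bounded_comp.
  have hC := @operator_norm_ge C x bC; rewrite x1 -/N in hC.
  apply: le_trans (hC (lexx _)).
  have := rinner_le (C x) x; rewrite x1 mulr1; apply: le_trans.
  have -> : C x = (1 - 7 * alpha / 8)%:C *: A (A x) + (alpha / 8)%:C *: B (B x).
    by [].
  have e1 : rinner (A (A x)) x = rnorm (A x) ^+ 2 by rewrite sA rnorm2.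
  have e2 : rinner (B (B x)) x = rnorm (B x) ^+ 2 by rewrite sB rnorm2.
  by rewrite rinnerDl !rinnerZl e1 e2.
have hb := buzano (A x) (B x) x1; rewrite -/a -/b in hb.
have am : 2 * (rnorm (A x) * rnorm (B x)) <= rnorm (A x) ^+ 2 + rnorm (B x) ^+ 2.
  by have := sqr_ge0 (rnorm (A x) - rnorm (B x)); lra.
have sq : 2 * (a * b) <= a ^+ 2 + b ^+ 2 by have := sqr_ge0 (a - b); lra.
rewrite nT.
have key : rnorm <[T x, x]> ^+ 2 <= W1 ^+ 2 / 4 + W2 / 4
    + (rnorm (A x) ^+ 2 + rnorm (B x) ^+ 2) / 8 by lra.
(* The coefficient of |Ax|^2 becomes (1 - alpha) + alpha / 8 = 1 - 7 alpha / 8. *)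
by have := ler_wpM2l h0 key; lra.
Qed.

End Suprema.

(** * Passage to the supremum over the unit sphere *)

Unset Implicit Arguments.

Theorem theorem2p5 (R : realType) (H : hilbertType R) (T : H -> H)
    (hT : bounded_operator T) (alpha : R) (h0 : 0 <= alpha) (h1 : alpha <= 1) :
  let absT := abs_operator T in
  let absTs := abs_operator (adjoint T) in
  alpha_norm alpha T ^+ 2 <=
    alpha / 4 * numerical_radius (absT + 'i *: absTs) ^+ 2
    + alpha / 4 * numerical_radius (absT \o absTs)
    + operator_norm ((1 - 7 * alpha / 8)%:C%C *: (absT \o absT)
                     + (alpha / 8)%:C%C *: (absTs \o absTs)).
Proof.
cbv zeta; set rhs := _ + operator_norm _.
have pointwise x : rnorm x = 1 ->
    alpha * rnorm <[T x, x]> ^+ 2 + (1 - alpha) * rnorm (T x) ^+ 2 <= rhs.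
  by move=> x1; exact: alpha_norm_pointwise.
rewrite /alpha_norm; set E := image _ _.
have ubE : ubound E (Num.sqrt rhs).
  by move=> _ [x /= x1 <-]; apply: ler_wsqrtr; exact: pointwise.
have [[x x1]|noE] := pselect (exists x : H, rnorm x = 1).
  have Ex : E (Num.sqrt (alpha * rnorm <[T x, x]> ^+ 2
      + (1 - alpha) * rnorm (T x) ^+ 2)) by exists x.
  have s0 : 0 <= sup E.
    by apply: le_trans (ub_le_sup _ Ex); [exact: sqrtr_ge0|exists (Num.sqrt rhs)].
  have sE : sup E <= Num.sqrt rhs by apply: ge_sup => //; eexists; exact: Ex.
  (* Needed to square back, since [Num.sqrt] is 0 on negative numbers. *)
  have rhs0 : 0 <= rhs.
    apply: le_trans (pointwise x x1).
    by rewrite addr_ge0 // mulr_ge0 ?sqr_ge0 ?subr_ge0.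
  by rewrite -(sqr_sqrtr rhs0) ler_sqr ?nnegrE ?sqrtr_ge0.
(* In the zero space the suprema over the unit sphere are [sup set0] = 0; the operator norm, taken
   over the closed ball, is still nonnegative. *)
have empty U (f : H -> U) : [set f x | x in [set x : H | rnorm x = 1]]%classic = set0.
  by apply/seteqP; split=> // _ [x /= x1 _]; apply: noE; exists x.
rewrite /E empty sup0 expr0n /= /rhs /numerical_radius !empty sup0 expr0n /=.
rewrite !mulr0 !add0r; apply: operator_norm_ge0.
have [pA pB _ _ _] := abs_operator_spec hT.
have bA := bounded_operator_norm pA.1; have bB := bounded_operator_norm pB.1.
by apply: norm_boundedD; apply: norm_boundedZ; apply: norm_bounded_comp.
Qed.
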